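(* Let $\mathcal{F}$ be a countable class of measurable functions $f:\Omega\to\mathbb{R}$ and let $\beta\in(0,1)$ be fixed. Let $\Phi(f,x,y)$, $f\in\mathcal{F}$, $x,y\in\Omega^n$, be a function that is invariant under all permutations of $(x,y)$ that switch only the same coordinates of $x$ and $y$ (i.e. that exchange $x_i$ with $y_i$ for $i$ in some subset of $\{1,\dots,n\}$). Assume that for any fixed $(x,y)$, $$\mathbb{P}_\varepsilon\Bigl(\sup_{f\in\mathcal{F}}\bigl(R_nf-\Phi(f,x,y)\bigr)>0\Bigr)<1-\beta .$$ Let $Q_nf$ denote either $Pf-P_nf$ for all $f\in\mathcal{F}$, or $P_nf-Pf$ for all $f\in\mathcal{F}$. Then, in either case, for any $t\ge\log\beta^{-1}$, $$\mathbb{P}\Bigl(\exists f\in\mathcal{F}:\ Q_nf\ge\mathbb{E}_y\Phi(f,x,y)+\sqrt{\frac{(Vf)\,t}{n}}\Bigr)\le\exp\Bigl(1-\bigl(\sqrt{t}-\sqrt{\log\beta^{-1}}\bigr)^2\Bigr).$$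
   Context: $(\Omega,P)$ is a probability space and $n\ge1$; $x=(x_1,\dots,x_n)$ and $y=(y_1,\dots,y_n)$ are independent, each with law $P^n$ on $\Omega^n$. $\mathbb{P}$ is the law of $x$, and $\mathbb{E}_y$ is expectation over $y$ with $x$ fixed. $\varepsilon=(\varepsilon_1,\dots,\varepsilon_n)$ are i.i.d. with $\mathbb{P}_\varepsilon(\varepsilon_i=1)=\mathbb{P}_\varepsilon(\varepsilon_i=-1)=1/2$, and $\mathbb{P}_\varepsilon$ is probability over $\varepsilon$ with $(x,y)$ fixed. Notation: $$Pf=\int f\,dP,\quad P_nf=\frac1n\sum_{i=1}^nf(x_i),\quad R_nf=\frac1n\sum_{i=1}^n\varepsilon_i\bigl(f(y_i)-f(x_i)\bigr),$$ $$Wf=W(f,x,y)=\frac4n\sum_{i=1}^n\bigl(f(y_i)-f(x_i)\bigr)^2,\qquad Vf=V(f,x)=\mathbb{E}_yW(f,x,y).$$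
   Formalization: At f with Vf = 0 the inequality in the event is required to be strict, since with ≥ the bound fails (F = {0}, Φ = 0, large t); each f is assumed P-integrable so that Pf is finite, and Φ(f,·,·) jointly measurable. *)

(* Defs.v *)
From HB Require Import structures.
From mathcomp Require Import all_boot all_order all_algebra.
From mathcomp Require Import all_classical all_reals all_analysis.

Set Implicit Arguments.
Unset Strict Implicit.
Unset Printing Implicit Defensive.

Import Order.TTheory GRing.Theory Num.Theory.
Import numFieldNormedType.Exports.

Local Open Scope classical_set_scope.
Local Open Scope ring_scope.

Section power_prob.
Context d (T : measurableType d) (R : realType).

Definition tuple_cons n (z : T * n.-tuple T) : n.+1.-tuple T :=
  [the n.+1.-tuple T of z.1 :: z.2].

Lemma measurable_tuple_cons n : measurable_fun [set: T * n.-tuple T] (@tuple_cons n).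
Proof. exact: measurable_cons. Qed.

HB.instance Definition _ n :=
  isMeasurableFun.Build _ _ _ _ (@tuple_cons n) (@measurable_tuple_cons n).

(* The product law P^n on n.-tuple T; [power_probE] gives its values on
   measurable rectangles, which determine it. *)
Fixpoint power_prob (P : probability T R) n : probability (n.-tuple T) R :=
  match n with
  | 0 => \d_([tuple] : 0.-tuple T)
  | m.+1 => distribution (P \x power_prob P m)%E (@tuple_cons m)
  end.

Lemma power_probE (P : probability T R) n (A : 'I_n -> set T) :
  (forall i, measurable (A i)) ->
  power_prob P n [set x | forall i, A i (tnth x i)] = (\prod_(i < n) P (A i))%E.
Proof.
elim: n A => [|n IH] A mA.
  rewrite big_ord0 /= diracE mem_set //=; by case.
rewrite big_ord_recl /= /distribution /pushforward.
rewrite (_ : _ @^-1` _ =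
  A ord0 `*` [set x : n.-tuple T | forall i, A (lift ord0 i) (tnth x i)]).
  rewrite product_measure1E //; last first.
    rewrite (_ : [set _ | _] = \bigcap_(i in [set: 'I_n])
      ((fun x : n.-tuple T => tnth x i) @^-1` A (lift ord0 i))); last first.
      by apply/seteqP; split=> x h i => [_|]; [exact: h | exact: h i I].
    apply: fin_bigcap_measurable => // i _.
    by rewrite -[X in measurable X]setTI; exact: measurable_tnth.
  by congr (_ * _)%E; apply: (IH (fun i => A (lift ord0 i))) => i; exact: mA.
apply/seteqP; split=> -[a x] /= h.
  split; first by have := h ord0.
  by move=> i; have := h (lift ord0 i); rewrite tnthS.
move=> i; case: (unliftP ord0 i) => [j ->|->]; last by case: h.
by rewrite tnthS; case: h.
Qed.

End power_prob.

Section rademacher.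
Context (R : realType).

Definition sign_of_bool (b : bool) : R := if b then 1 else -1.

Lemma measurable_sign_of_bool : measurable_fun [set: bool] sign_of_bool.
Proof. by []. Qed.

HB.instance Definition _ :=
  isMeasurableFun.Build _ _ _ _ sign_of_bool measurable_sign_of_bool.

Definition rademacher : probability R R :=
  distribution (bernoulli_prob (2^-1 : R)) sign_of_bool.

Lemma rademacherE :
  rademacher [set 1] = (2^-1)%:E /\ rademacher [set -1] = (2^-1)%:E.
Proof.
have h : (0 <= (2^-1 : R) <= 1) by rewrite invr_ge0 ler0n invf_le1 ?ler1n.
have n11 : (1 : R) != -1 by rewrite -subr_eq0 opprK (pnatr_eq0 R 2).
split; rewrite /= /distribution /pushforward /bernoulli_prob h.
- rewrite (_ : _ @^-1` _ = [set true]) ?fsbig_set1 //.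
  by apply/seteqP; split=> -[] //= /eqP; rewrite eq_sym (negbTE n11).
- rewrite (_ : _ @^-1` _ = [set false]) ?fsbig_set1 /=.
    by rewrite {1}[1](splitr 1) mul1r addrK.
  by apply/seteqP; split=> -[] //= /eqP; rewrite (negbTE n11).
Qed.

End rademacher.

Section empirical.
Context d (Omega : measurableType d) (R : realType) (P : probability Omega R).
Variable n : nat.
Implicit Types (f : Omega -> R) (x y : n.-tuple Omega) (eps : n.-tuple R).

Definition mean f : R := \int[P]_w f w.

Definition emp_mean f x : R := n%:R^-1 * \sum_(i < n) f (tnth x i).

Definition sym_emp eps f x y : R :=
  n%:R^-1 * \sum_(i < n) tnth eps i * (f (tnth y i) - f (tnth x i)).

Definition W f x y : R :=
  4 / n%:R * \sum_(i < n) (f (tnth y i) - f (tnth x i)) ^+ 2.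

(* Takes the value +oo when f is not square integrable. *)
Definition V f x : \bar R := ('E_(power_prob P n)[W f x])%E.

Definition deviation_bound (Phi : (Omega -> R) -> n.-tuple Omega -> n.-tuple Omega -> R)
    (t : R) f x : \bar R :=
  ('E_(power_prob P n)[Phi f x] + sqrte (V f x * (t / n%:R)%:E))%E.

(* x with its coordinates in I replaced by those of y, so that
   (switch I x y, switch I y x) is (x, y) with x_i and y_i exchanged for i in I. *)
Definition switch (I : {set 'I_n}) x y : n.-tuple Omega :=
  [tuple if i \in I then tnth y i else tnth x i | i < n].

End empirical.

(* Main.v *)
Require Import Defs.
From mathcomp Require Import all_boot all_order all_algebra.
From mathcomp Require Import all_classical all_reals all_analysis.
From mathcomp Require Import measurable_realfun.
From mathcomp Require Import ring lra.

Set Implicit Arguments.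
Unset Strict Implicit.
Unset Printing Implicit Defensive.

Import Order.TTheory GRing.Theory Num.Theory.
Import numFieldNormedType.Exports.

Local Open Scope classical_set_scope.
Local Open Scope ring_scope.

(** The square root in the deviation bound is removed by the identity
  sup_(r real) 4 n r^2 (q - r^2 w) = n q^2 / w    (q, w > 0).
Put L = ln beta^-1 and
  tilt r f x y = 4 n r^2 (gap - Phi f x y - r^2 W f x y),
where gap is P_n f (y) - P_n f (x) up to a sign.  With x fixed, the mean of gap
over y is Q f x, so a point x of the event is one at which the y-means of the
tilts of some f have a supremum over r of at least t.  Jensen's inequality for
the exponential then gives
  exp (kappa t) <= E_y S,    S = sup over f and r of exp (kappa tilt r f x y),
for each kappa in [0, 1) ([deviation_le_score]); rational r suffice, so S is
measurable.  Markov's inequality reduces the theorem to a bound on E_x E_y S.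

The law of (x, y) does not change when x_i and y_i are exchanged for i in a set
I ([integral_switch]), Phi and W are invariant under these exchanges, and gap
turns into R_n f with signs determined by I.  Averaging over I replaces S by
the supremum of exp (kappa 4 n r^2 (R_n f - Phi - r^2 W)) averaged over the
signs, with (x, y) fixed.

Now only the cube {-1, 1}^n is left.  Let A be the set of the sign vectors at
which R_n f <= Phi for all f; it has probability more than beta.  R_n f is
linear in the signs and W is a multiple of the square norm of its coefficients,
so the exponent is at most kappa dist (eps, conv A)^2 / 4.  Talagrand's
inequality with a parameter alpha >= 0 and kappa = alpha / (alpha + 1),
  E exp (kappa dist (eps, conv A)^2 / 4) <= P(A)^(- alpha),
is [cube_concentration].  Altogether the event has probability at most
exp (alpha L - kappa t), which for alpha + 1 = sqrt (t / L) is
exp (- (sqrt t - sqrt L)^2) ([optimal_exponent]). *)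

(** * The bound cosh z <= exp (z^2 / 2) *)

Section exponential_inequalities.
Context (R : realType).
Implicit Types x z : R.

Lemma sinh_le_cosh z : 0 <= z -> expR z - expR (- z) <= z * (expR z + expR (- z)).
Proof.
move=> z0.
pose f (x : R) := (1 - x) * expR x - (1 + x) * expR (- x).
have df x : is_derive x 1 f (x * (expR (- x) - expR x)).
  by rewrite /f; apply: is_derive_eq; rewrite /GRing.scale/=; ring.
have : f z <= f 0.
  apply: (@ler0_derive1_nincry _ f 0) => // [x|].
  - rewrite in_itv/= andbT derive1E derive_val => x0.
    rewrite mulr_ge0_le0 ?(ltW x0)// subr_le0 ler_expR; lra.
  - by apply: derivable_within_continuous => x _.
rewrite /f oppr0 expR0; lra.
Qed.

(** Both sides agree at 0, and the logarithmic derivative of the left side is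
tanh z <= z. *)
Lemma cosh_le z : expR z + expR (- z) <= 2 * expR (z ^+ 2 / 2).
Proof.
wlog z0 : z / 0 <= z => [H|].
  have [z0|z0] := leP 0 z; first exact: H.
  by have := H (- z); rewrite opprK sqrrN addrC => -> //; lra.
pose f (x : R) := (expR x + expR (- x)) * expR (- (x ^+ 2 / 2)).
have df x : is_derive x 1 f
    ((expR x - expR (- x) - x * (expR x + expR (- x))) * expR (- (x ^+ 2 / 2))).
  by rewrite /f; apply: is_derive_eq; rewrite /GRing.scale/=; field.
have : f z <= f 0.
  apply: (@ler0_derive1_nincry _ f 0) => // [x|].
  - rewrite in_itv/= andbT derive1E derive_val => x0.
    by rewrite mulr_le0_ge0 ?expR_ge0// subr_le0 sinh_le_cosh// ltW.
  - by apply: derivable_within_continuous => x _.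
rewrite /f expr0n/= mul0r !oppr0 expR0 (expRN (_ / 2)) mulr1.
by rewrite ler_pdivrMr; [lra|exact: expR_gt0].
Qed.

Lemma one_plus_expR_le z : 1 + expR z <= 2 * expR (z / 2 + z ^+ 2 / 8).
Proof.
have := cosh_le (z / 2).
rewrite -(ler_pM2l (expR_gt0 (z / 2))) mulrDr -!expRD.
have -> : z / 2 + z / 2 = z by field.
rewrite subrr expR0 mulrCA -expRD addrC => /le_trans; apply.
by rewrite ler_pM2l// ler_expR expr_div_n; lra.
Qed.

End exponential_inequalities.

(** * The two-point inequality *)

Section cube.
Context (R : realType) (alpha : R).

Definition kappa : R := alpha / (alpha + 1).

(** With l = ln (p / q), this is the two-point inequality at the minimiser
th = (alpha + 1) l / 2 of the exponent of [two_point].  By [one_plus_expR_le],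
both logarithms are controlled to second order by their Taylor expansions, and
the second order terms are then compared using v <= alpha l. *)
Lemma two_point_log (l : R) : 0 <= alpha -> 0 <= l -> l <= 2 / (alpha + 1) ->
  1 + expR (alpha * (l - (alpha + 1) * l ^+ 2 / 4)) <=
    2 * expR (- alpha * ln ((1 + expR (- l)) / 2)).
Proof.
move=> alpha0 l0 lle.
have a1 : 0 < alpha + 1 by lra.
have lle2 : (alpha + 1) * l <= 2 by move: lle; rewrite ler_pdivlMr// mulrC.
set v := alpha * _.
apply: (le_trans (one_plus_expR_le v)); rewrite ler_pM2l// ler_expR.
have e0 := expR_gt0 (- l).
have lnle : ln ((1 + expR (- l)) / 2) <= - l / 2 + l ^+ 2 / 8.
  rewrite -ler_expR lnK ?posrE; last by lra.
  by rewrite ler_pdivrMr// mulrC; have := one_plus_expR_le (- l); rewrite sqrrN.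
have sqle : (alpha + 1) * l ^+ 2 <= 2 * l by rewrite expr2 mulrA ler_wpM2r.
have sq0 : 0 <= (alpha + 1) * l ^+ 2 by rewrite mulr_ge0 ?sqr_ge0// ltW.
have v0 : 0 <= v by rewrite /v; apply: mulr_ge0 => //; lra.
have vle : v <= alpha * l by rewrite /v ler_wpM2l//; lra.
have v2 : v ^+ 2 <= (alpha * l) ^+ 2 by rewrite ler_sqr// nnegrE; lra.
have H := ler_wpM2l alpha0 lnle.
have vE : v / 2 = alpha * l / 2 - alpha * (alpha + 1) * l ^+ 2 / 8.
  by rewrite /v; field.
clearbody v; rewrite exprMn in v2; lra.
Qed.

(** The induction step of [cube_concentration] in numbers: p and q are the
probabilities of the larger and of the smaller half of a set, and th is the
weight given to the larger half when a point of the smaller half is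
approximated.  The exponent is quadratic in th; its minimiser is used while it
lies in [0, 1].  Beyond, th = 1: the left side is then constant while the right
side increases with p / q.  Only th = 1 makes sense when the smaller half is
empty. *)
Lemma two_point (p q : R) : 0 <= alpha -> 0 < p -> 0 <= q -> q <= p ->
  exists2 th, 0 <= th <= 1 /\ (0 < q \/ th = 1) &
    1 + expR (kappa * th ^+ 2 + alpha * (1 - th) * (ln p - ln q)) <=
      2 * expR (- alpha * (ln ((p + q) / 2) - ln p)).
Proof.
move=> alpha0 p0 q0 qp.
have a1 : 0 < alpha + 1 by lra.
have pq : ln ((p + q) / 2) - ln p = ln ((1 + q / p) / 2).
  by rewrite -ln_div ?posrE; [congr ln; field; lra|lra|lra].
rewrite pq.
have qp0 : 0 <= q / p by rewrite divr_ge0// ltW.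
pose l0 := 2 / (alpha + 1).
have l00 : 0 <= l0 by rewrite divr_ge0 ?ltW.
have [qpl|qpl] := leP (q / p) (expR (- l0)).
  exists 1; first by split; [rewrite ler01 lexx|right].
  have := two_point_log alpha0 l00 (lexx _).
  rewrite subrr mulr0 mul0r addr0 expr1n mulr1.
  have -> : alpha * (l0 - (alpha + 1) * l0 ^+ 2 / 4) = kappa.
    by rewrite /l0 /kappa; field; lra.
  move=> /le_trans; apply; rewrite ler_pM2l// ler_expR.
  have e0 := expR_gt0 (- l0).
  rewrite !mulNr lerN2 ler_wpM2l// ler_ln ?posrE; lra.
have q00 : 0 < q.
  by rewrite -(pmulr_lgt0 _ (_ : 0 < p^-1)) ?invr_gt0//; apply: lt_trans qpl; exact: expR_gt0.
pose l := ln p - ln q.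
have el : expR (- l) = q / p.
  by rewrite /l opprB -ln_div ?posrE// lnK// posrE divr_gt0.
have ll0 : l <= l0 by move: qpl; rewrite -el ltr_expR; lra.
have l_ge0 : 0 <= l by rewrite /l subr_ge0 ler_ln ?posrE.
exists ((alpha + 1) * l / 2).
  split; last by left.
  rewrite divr_ge0 ?mulr_ge0//; last by lra.
  rewrite ler_pdivrMr// mul1r mulrC -ler_pdivlMr//; exact: ll0.
have := two_point_log alpha0 l_ge0 ll0; rewrite el; congr (_ + expR _ <= _).
by rewrite -/l /kappa; field; lra.
Qed.

Lemma expR_convex (th a b : R) : 0 <= th <= 1 ->
  expR ((1 - th) * a + th * b) <= (1 - th) * expR a + th * expR b.
Proof.
move=> /andP[th0 th1]; set m := _ + _.
have ha := expR_ge1Dx (a - m); have hb := expR_ge1Dx (b - m).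
have eE c : expR c = expR (c - m) * expR m by rewrite -expRD subrK.
rewrite (eE a) (eE b) !mulrA -mulrDl.
rewrite ler_peMl ?expR_ge0//.
have th1' : 0 <= 1 - th by lra.
have := ler_wpM2l th1' ha; have := ler_wpM2l th0 hb.
have : (1 - th) * (a - m) + th * (b - m) = 0 by rewrite /m; ring.
clearbody m; lra.
Qed.

Lemma sum_expR_hoelder (I : finType) (N th m1 m2 : R) (X Y : I -> R) :
  0 <= th <= 1 ->
  (th = 1 \/ \sum_i expR (X i) <= N * expR m1) ->
  \sum_i expR (Y i) <= N * expR m2 ->
  \sum_i expR ((1 - th) * X i + th * Y i) <= N * expR ((1 - th) * m1 + th * m2).
Proof.
move=> th01 + HY; have /andP[th0 th1] := th01; case=> [->|HX].
  by rewrite subrr mul0r add0r mul1r; under eq_bigr do rewrite mul0r add0r mul1r.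
rewrite -ler_pdivrMr ?expR_gt0// mulr_suml.
apply: (@le_trans _ _ (\sum_i ((1 - th) * (expR (X i) / expR m1)
    + th * (expR (Y i) / expR m2)))).
  apply: ler_sum => i _; rewrite -!expRN -!expRD.
  set a := X i - m1; set b := Y i - m2.
  have -> : (1 - th) * X i + th * Y i - ((1 - th) * m1 + th * m2) =
    (1 - th) * a + th * b by rewrite /a /b; ring.
  exact: expR_convex.
rewrite big_split/= -!mulr_sumr -!mulr_suml.
have : (\sum_i expR (X i)) / expR m1 <= N by rewrite ler_pdivrMr ?expR_gt0.
have : (\sum_i expR (Y i)) / expR m2 <= N by rewrite ler_pdivrMr ?expR_gt0.
by nra.
Qed.

End cube.

(** * Convex distance on the discrete cube *)

Section cube_concentration.
Context (R : realType).
Local Notation sgn := (sign_of_bool R).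

Lemma sum_tuple_bool n (V : nmodType) (G : n.+1.-tuple bool -> V) :
  \sum_a G a = \sum_(b : bool) \sum_(c : n.-tuple bool) G [tuple of b :: c].
Proof.
rewrite pair_big/= (reindex (fun p : bool * n.-tuple bool => [tuple of p.1 :: p.2])) //=.
exists (fun a : n.+1.-tuple bool => (thead a, [tuple of behead a])) => /= [[b c] _|a _] /=.
  by congr pair; apply: val_inj.
by rewrite -tuple_eta.
Qed.

Definition sdot n (u : 'I_n -> R) (a : n.-tuple bool) : R :=
  \sum_i sgn (tnth a i) * u i.

Lemma sdot_cons n (u : 'I_n.+1 -> R) b (c : n.-tuple bool) :
  sdot u [tuple of b :: c] = sgn b * u ord0 + sdot (fun i => u (lift ord0 i)) c.
Proof.
rewrite /sdot big_ord_recl tnth0; congr (_ + _).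
by apply: eq_bigr => i _; rewrite tnthS.
Qed.

(** For nonempty A, by duality, the least such g is a quarter of the square
distance from the sign vector of a to the convex hull of A: that quarter is the
supremum of <u, a> - max_A <u, .> - |u|^2 over u.  Stated for linear functionals, the bound
needs no convex combinations in its proof and applies as such to R_n f. *)
Definition dist_le n (A : pred (n.-tuple bool)) (a : n.-tuple bool) (g : R) :=
  forall (u : 'I_n -> R) (w : R), (forall c, A c -> sdot u c <= w) ->
    sdot u a <= w + \sum_i u i ^+ 2 + g.

(** A point (s, c) is approximated by combining, with weight 1 - th, points in
its own half of the cube and, with weight th, points in the opposite half; the
first coordinate is then off by 2 th, which costs th^2 after division by 4. *)
Lemma dist_le_cons n (A : pred (n.+1.-tuple bool)) s (c : n.-tuple bool) th g1 g2 :
  0 <= th <= 1 ->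
  th = 1 \/ dist_le (fun c => A [tuple of s :: c]) c g1 ->
  th = 0 \/ dist_le (fun c => A [tuple of (~~ s) :: c]) c g2 ->
  dist_le A [tuple of s :: c] (th ^+ 2 + (1 - th) * g1 + th * g2).
Proof.
move=> /andP[th0 th1] D1 D2 u w Aw.
pose v i := u (lift ord0 i); set S := \sum_i v i ^+ 2.
have th1' : 0 <= 1 - th by lra.
have H1 : (1 - th) * sdot v c <= (1 - th) * (w - sgn s * u ord0 + S + g1).
  case: D1 => [->|D1]; first by rewrite subrr !mul0r.
  apply: ler_wpM2l => //; apply: D1 => c' Ac'.
  by have := Aw _ Ac'; rewrite sdot_cons -/v; lra.
have H2 : th * sdot v c <= th * (w + sgn s * u ord0 + S + g2).
  case: D2 => [->|D2]; first by rewrite !mul0r.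
  apply: ler_wpM2l => //; apply: D2 => c' Ac'.
  by have := Aw _ Ac'; rewrite sdot_cons -/v; case: (s) => /=; lra.
rewrite sdot_cons big_ord_recl -/v -/S.
(* The error term 2 th s u_0 of the first coordinate is paid by u_0^2 + th^2. *)
have : 0 <= (sgn s * u ord0 - th) ^+ 2 by exact: sqr_ge0.
have -> : (sgn s * u ord0 - th) ^+ 2 = u ord0 ^+ 2 - 2 * th * (sgn s * u ord0) + th ^+ 2.
  by case: (s) => /=; ring.
by clearbody S; nra.
Qed.

(** The cardinal of A as a sum of indicators, which [sum_tuple_bool] splits. *)
Definition hits n (A : pred (n.-tuple bool)) : R := \sum_a (A a)%:R.

Lemma hits_ge0 n (A : pred (n.-tuple bool)) : 0 <= hits A.
Proof. by rewrite sumr_ge0. Qed.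

Lemma hits_gt0 n (A : pred (n.-tuple bool)) : 0 < hits A -> exists a, A a.
Proof.
move=> h; apply/not_existsP => nA; move: h.
by rewrite /hits big1 ?ltxx// => a _; case: (boolP (A a)) => // /nA.
Qed.

(** Talagrand's convex distance inequality on the cube, in the form with a free
exponent alpha.  Induction on the dimension: points in the larger half s use
the approximation within that half, points in the smaller half mix both halves
as in [dist_le_cons].  Hoelder's inequality separates the two contributions,
and [two_point] chooses the weight. *)
Lemma cube_concentration (alpha : R) : 0 <= alpha ->
  forall n (A : pred (n.-tuple bool)), 0 < hits A ->
  exists2 g : n.-tuple bool -> R, (forall a, dist_le A a (g a)) &
    \sum_a expR (kappa alpha * g a) <= 2 ^+ n * expR (- alpha * ln (hits A / 2 ^+ n)).
Proof.
move=> alpha0; elim=> [|n IH] A A0.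
  have [a Aa] := hits_gt0 A0.
  exists (fun=> 0).
    move=> b u w /(_ _ Aa); rewrite (tuple0 a) (tuple0 b) big_ord0 !addr0; exact.
  have -> : hits A = 1.
    by rewrite /hits (bigD1 a)//= Aa big1 ?addr0// => b; rewrite (tuple0 a) (tuple0 b) eqxx.
  rewrite expr0 divr1 ln1 mulr0 expR0 mul1r.
  by rewrite (bigD1 a)//= mulr0 expR0 big1 ?addr0// => b; rewrite (tuple0 a) (tuple0 b) eqxx.
pose B b := fun c : n.-tuple bool => A [tuple of b :: c].
have hitsE s : hits A = hits (B s) + hits (B (~~ s)).
  by rewrite /hits sum_tuple_bool big_bool /B; case: s => //=; rewrite addrC.
have [s s_ge] : exists s, hits (B (~~ s)) <= hits (B s).
  by have [h|/ltW h] := leP (hits (B false)) (hits (B true)); [exists true|exists false].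
have p0 : 0 < hits (B s) by move: A0; rewrite (hitsE s); lra.
set p := hits (B s) in p0 s_ge *; set q := hits (B (~~ s)) in s_ge *.
have N0 : 0 < 2 ^+ n :> R by rewrite exprn_gt0.
have [th [th01 qth] thle] := two_point alpha0 p0 (hits_ge0 _) s_ge.
have [g1 D1 g1le] := IH _ p0.
(* If the smaller half is empty then th = 1 and g2 has weight 0. *)
have [g2 D2 g2le] : exists2 g : n.-tuple bool -> R,
    th = 1 \/ (forall a, dist_le (B (~~ s)) a (g a)) &
    th = 1 \/ \sum_a expR (kappa alpha * g a) <= 2 ^+ n * expR (- alpha * ln (q / 2 ^+ n)).
  case: qth => [/IH [g ? ?]|->]; first by exists g; right.
  by exists (fun=> 0); left.
pose g (a : n.+1.-tuple bool) : R := let c := [tuple of behead a] in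
  if thead a == s then g1 c else th ^+ 2 + (1 - th) * g2 c + th * g1 c.
have gE b (c : n.-tuple bool) : g [tuple of b :: c] =
    if b == s then g1 c else th ^+ 2 + (1 - th) * g2 c + th * g1 c.
  have cE : [tuple of behead [tuple of b :: c]] = c :> n.-tuple bool by apply: val_inj.
  by rewrite /g theadE cE.
exists g.
  case/tupleP=> b c.
  rewrite gE; have [->|bs] := eqVneq b s.
    have -> : g1 c = 0 ^+ 2 + (1 - 0) * g1 c + 0 * 0 by ring.
    by apply: dist_le_cons; [rewrite lexx ler01|right; exact: D1|left].
  have {bs} -> : b = ~~ s by move: bs; case: (b); case: (s).
  apply: dist_le_cons => //.
    by case: D2 => D2; [left|right; exact: D2].
  by right; rewrite negbK; exact: D1.
rewrite sum_tuple_bool.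
have -> : \sum_(b : bool) \sum_(c : n.-tuple bool) expR (kappa alpha * g [tuple of b :: c])
  = \sum_c expR (kappa alpha * g1 c) +
    \sum_c expR (kappa alpha * (th ^+ 2 + (1 - th) * g2 c + th * g1 c)).
  by rewrite big_bool; case: (s) gE => gE; [|rewrite addrC]; congr (_ + _);
    apply: eq_bigr => c _; rewrite gE.
have Hle : \sum_c expR (kappa alpha * (th ^+ 2 + (1 - th) * g2 c + th * g1 c)) <=
    2 ^+ n * expR (- alpha * ln (p / 2 ^+ n)) *
    expR (kappa alpha * th ^+ 2 + alpha * (1 - th) * (ln p - ln q)).
  have := sum_expR_hoelder th01 g2le g1le.
  rewrite -(ler_pM2r (expR_gt0 (kappa alpha * th ^+ 2))) mulr_suml.
  under eq_bigr do rewrite -expRD.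
  rewrite -!(mulrA (2 ^+ n)) -!expRD => H.
  have -> : \sum_c expR (kappa alpha * (th ^+ 2 + (1 - th) * g2 c + th * g1 c)) =
    \sum_c expR ((1 - th) * (kappa alpha * g2 c) + th * (kappa alpha * g1 c) +
             kappa alpha * th ^+ 2) by apply: eq_bigr => c _; congr expR; ring.
  apply: (le_trans H); rewrite ler_pM2l// ler_expR.
  rewrite [ln (p / _)]ln_div ?posrE//.
  case: qth => [q0|->]; last by lra.
  by rewrite [ln (q / _)]ln_div ?posrE//; lra.
apply: (le_trans (lerD g1le Hle)).
rewrite (exprS 2 n) -[2 * _ * _]mulrA [leRHS]mulrCA -[2 ^+ n * _ * _]mulrA -mulrDr ler_pM2l//.
rewrite -[X in X + _ <= _]mulr1 -mulrDr.
rewrite (hitsE s) -/p -/q.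
apply: (le_trans (ler_wpM2l (expR_ge0 _) thle)).
rewrite mulrCA ler_pM2l// -expRD ler_expR.
have pq0 : 0 < (p + q) / 2 by rewrite divr_gt0// ltr_wpDr// hits_ge0.
rewrite invfM mulrA [ln (p / _)]ln_div ?posrE//.
by rewrite [ln ((p + q) / 2 / _)]ln_div ?posrE//; lra.
Qed.

End cube_concentration.

(** * Exchanging coordinates of two independent samples *)

Section power_prob_integral.
Context d (T : measurableType d) (R : realType) (P : probability T R).
Local Open Scope ereal_scope.

Lemma integral_power_probS n (G : n.+1.-tuple T -> \bar R) :
  measurable_fun [set: n.+1.-tuple T] G -> (forall x, 0 <= G x) ->
  \int[power_prob P n.+1]_x G x =
  \int[P]_x0 \int[power_prob P n]_x G (tuple_cons (x0, x)).
Proof.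
move=> mG G0.
rewrite /= ge0_integral_distribution// fubini_tonelli1//; first exact: measurableT_comp.
by move=> x; exact: G0.
Qed.

Lemma measurable_cons_pair n : measurable_fun setT
  (fun z : (T * T) * (n.-tuple T * n.-tuple T) =>
    (tuple_cons (z.1.1, z.2.1), tuple_cons (z.1.2, z.2.2))).
Proof.
apply: measurable_fun_pair; apply: (measurableT_comp (@measurable_tuple_cons _ T n));
  by apply: measurable_fun_pair; exact: measurableT_comp.
Qed.

(** The first coordinates of x and y come first on the right, so that the
induction in [integral_switch] can treat them separately from the tails. *)
Lemma integral_power_prob2S n (h : n.+1.-tuple T * n.+1.-tuple T -> \bar R) :
  measurable_fun [set: n.+1.-tuple T * n.+1.-tuple T] h -> (forall z, 0 <= h z) ->
  \int[power_prob P n.+1]_x \int[power_prob P n.+1]_y h (x, y) =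
  \int[P]_x0 \int[P]_y0 \int[power_prob P n]_x \int[power_prob P n]_y
    h (tuple_cons (x0, x), tuple_cons (y0, y)).
Proof.
move=> mh h0.
rewrite integral_power_probS; last 2 first.
- exact: (measurable_fun_fubini_tonelli_F h).
- by move=> x; apply: integral_ge0.
apply: eq_integral => x0 _.
transitivity (\int[power_prob P n]_x \int[P]_y0 \int[power_prob P n]_y
    h (tuple_cons (x0, x), tuple_cons (y0, y))).
  apply: eq_integral => x _; apply: integral_power_probS => //.
  exact: measurable_fun_pair2.
rewrite (fubini_tonelli (fun z : n.-tuple T * T => \int[power_prob P n]_y
    h (tuple_cons (x0, z.1), tuple_cons (z.2, y))))//.
- apply: (measurable_fun_fubini_tonelli_F (fun w : (n.-tuple T * T) * n.-tuple T =>
    h (tuple_cons (x0, w.1.1), tuple_cons (w.1.2, w.2)))) => //.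
  apply: (measurableT_comp mh); apply: measurable_fun_pair;
    apply: (measurableT_comp (@measurable_tuple_cons _ T n));
    apply: measurable_fun_pair => //; exact: measurableT_comp.
- by move=> z; apply: integral_ge0.
Qed.

Definition tail_set n (I : {set 'I_n.+1}) : {set 'I_n} := [set i | lift ord0 i \in I]%SET.

Lemma switch_cons n (I : {set 'I_n.+1}) x0 y0 (x y : n.-tuple T) :
  switch I (tuple_cons (x0, x)) (tuple_cons (y0, y)) =
  tuple_cons (if ord0 \in I then y0 else x0, switch (tail_set I) x y).
Proof.
apply: eq_from_tnth => i; rewrite tnth_mktuple.
case: (unliftP ord0 i) => [j ->|->]; last by rewrite !tnth0; case: ifP.
by rewrite !tnthS tnth_mktuple inE.
Qed.

Lemma measurable_switch n (I : {set 'I_n}) :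
  measurable_fun [set: n.-tuple T * n.-tuple T]
    (fun z : n.-tuple T * n.-tuple T => switch I z.1 z.2).
Proof.
apply/measurable_fun_tnthP => i.
apply: (eq_measurable_fun (fun z : n.-tuple T * n.-tuple T =>
    if i \in I then tnth z.2 i else tnth z.1 i)).
  by move=> z _; rewrite /= tnth_mktuple.
by case: (i \in I); apply: (@measurableT_comp _ _ _ _ _ _ (fun x : n.-tuple T => tnth x i)) => //;
  exact: measurable_tnth.
Qed.

Lemma measurable_switch_pair n (I : {set 'I_n}) :
  measurable_fun [set: n.-tuple T * n.-tuple T]
    (fun z : n.-tuple T * n.-tuple T => (switch I z.1 z.2, switch I z.2 z.1)).
Proof.
apply/measurable_fun_pairP; split; first exact: measurable_switch.
by apply: (measurableT_comp (f := fun z => switch I z.1 z.2) (g := fun z => (z.2, z.1)));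
  [exact: measurable_switch|exact: measurable_fun_pair].
Qed.

(** The n pairs (x_i, y_i) are independent and each of them is exchangeable.
The first pair is exchanged by Tonelli's theorem, the others by induction. *)
Lemma integral_switch n (I : {set 'I_n}) (h : n.-tuple T * n.-tuple T -> \bar R) :
  measurable_fun [set: n.-tuple T * n.-tuple T] h -> (forall z, 0 <= h z) ->
  \int[power_prob P n]_x \int[power_prob P n]_y h (switch I x y, switch I y x) =
  \int[power_prob P n]_x \int[power_prob P n]_y h (x, y).
Proof.
elim: n I h => [|n IH] I h mh h0.
  apply: eq_integral => x _; apply: eq_integral => y _.
  by congr (h (_, _)); apply: eq_from_tnth => -[].
rewrite (integral_power_prob2S (h := fun z => h (switch I z.1 z.2, switch I z.2 z.1)))//; last first.
  exact: (measurableT_comp mh (measurable_switch_pair I)).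
rewrite (integral_power_prob2S mh h0).
pose H (z : T * T) := \int[power_prob P n]_x \int[power_prob P n]_y
  h (tuple_cons (z.1, x), tuple_cons (z.2, y)).
have mhz z : measurable_fun setT (fun w : n.-tuple T * n.-tuple T =>
    h (tuple_cons (z.1, w.1), tuple_cons (z.2, w.2))).
  exact: (measurable_fun_pair2 z (measurableT_comp mh (@measurable_cons_pair n))).
have mH : measurable_fun [set: T * T] H.
  apply: (measurable_fun_fubini_tonelli_F (fun v : (T * T) * n.-tuple T =>
    \int[power_prob P n]_y h (tuple_cons (v.1.1, v.2), tuple_cons (v.1.2, y)))).
  - apply: (measurable_fun_fubini_tonelli_F (fun w : ((T * T) * n.-tuple T) * n.-tuple T =>
      h (tuple_cons (w.1.1.1, w.1.2), tuple_cons (w.1.1.2, w.2)))) => //.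
    apply: (measurableT_comp mh).
    apply: (measurableT_comp (@measurable_cons_pair n)
      (g := fun w : ((T * T) * n.-tuple T) * n.-tuple T => (w.1.1, (w.1.2, w.2)))).
    apply: measurable_fun_pair; first exact: measurableT_comp.
    by apply: measurable_fun_pair => //; exact: measurableT_comp.
  - by move=> v; apply: integral_ge0.
transitivity (\int[P]_x0 \int[P]_y0 if ord0 \in I then H (y0, x0) else H (x0, y0)).
  apply: eq_integral => x0 _; apply: eq_integral => y0 _.
  pose z := if ord0 \in I then (y0, x0) else (x0, y0).
  transitivity (H z); last by rewrite /z; case: ifP.
  apply: eq_trans (IH (tail_set I) _ (mhz z) (fun w => h0 _)).
  apply: eq_integral => x _; apply: eq_integral => y _.
  by rewrite !switch_cons /z; case: ifP.
case: (ord0 \in I); last reflexivity.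
have H0 z : 0 <= H z by apply: integral_ge0 => x _; apply: integral_ge0.
have mHs : measurable_fun [set: T * T] (fun z => H (z.2, z.1)).
  by apply: (measurableT_comp mH); exact: measurable_fun_pair.
exact: (fubini_tonelli (fun z => H (z.2, z.1)) mHs (fun z => H0 _)).
Qed.

End power_prob_integral.

(** * Rademacher vectors and marginals of power laws *)

Section rademacher_cube.
Context (R : realType).
Local Open Scope ereal_scope.

Definition signs n (a : n.-tuple bool) : n.-tuple R := [tuple sign_of_bool R (tnth a i) | i < n].

Lemma sign_of_bool_inj : injective (sign_of_bool R).
Proof.
have n11 : (1 : R)%R != (-1)%R by rewrite -subr_eq0 opprK (pnatr_eq0 R 2).
by case=> -[]//= /eqP; rewrite ?(negbTE n11)// eq_sym (negbTE n11).
Qed.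

Lemma signs_inj n : injective (@signs n).
Proof.
move=> a b ab; apply: eq_from_tnth => i; apply: sign_of_bool_inj.
by have := congr1 (fun x => tnth x i) ab; rewrite !tnth_mktuple.
Qed.

Lemma set1_signs n (a : n.-tuple bool) :
  [set signs a] = [set x | forall i, [set sign_of_bool R (tnth a i)] (tnth x i)].
Proof.
apply/seteqP; split=> [x -> i|x h] /=; first by rewrite tnth_mktuple.
by apply: eq_from_tnth => i; rewrite tnth_mktuple h.
Qed.

Lemma measurable_signs n (a : n.-tuple bool) : measurable [set signs a].
Proof.
rewrite set1_signs.
have -> : [set x : n.-tuple R | forall i, [set sign_of_bool R (tnth a i)] (tnth x i)] =
  \bigcap_(i in [set: 'I_n]) ((fun x : n.-tuple R => tnth x i) @^-1` [set sign_of_bool R (tnth a i)]).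
  by apply/seteqP; split=> x h i => [_|]; [exact: h | exact: h i I].
apply: fin_bigcap_measurable => // i _.
by rewrite -[X in measurable X]setTI; exact: measurable_tnth.
Qed.

Lemma power_rademacher1 n (a : n.-tuple bool) :
  power_prob (rademacher R) n [set signs a] = (2 ^- n)%:E.
Proof.
rewrite set1_signs (power_probE (rademacher R) (A := fun i => [set sign_of_bool R (tnth a i)]))//.
transitivity (\prod_(i < n) (2^-1 : R)%:E).
  by apply: eq_bigr => i _; have [h1 h2] := rademacherE R; case: (tnth a i).
by rewrite prodEFin prodr_const card_ord exprVn.
Qed.

Lemma hits_le_power_rademacher n (A : pred (n.-tuple bool)) (B : set (n.-tuple R)) :
  measurable B -> (forall a, A a -> B (signs a)) ->
  (hits R A / 2 ^+ n)%:E <= power_prob (rademacher R) n B.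
Proof.
move=> mB AB.
apply: (@le_trans _ _ (power_prob (rademacher R) n (\bigcup_(a in [set` A]) [set signs a]))); last first.
  apply: le_measure; rewrite ?inE//.
    by apply: fin_bigcup_measurable => // a _; exact: measurable_signs.
  by move=> x [a /= Aa ->]; exact: AB.
rewrite measure_fin_bigcup//; last 2 first.
- by move=> a b _ _ [x [-> /signs_inj]].
- by move=> a _; exact: measurable_signs.
rewrite -(bigfs _ (index_enum_uniq _)) => [|a _]; last by rewrite mem_index_enum.
rewrite (eq_bigr (fun=> (2 ^- n)%:E)); last by move=> a _; exact: power_rademacher1.
rewrite sumEFin lee_fin /hits mulr_suml [leRHS]big_mkcond/= ler_sum// => a _.
by case: (A a); rewrite ?mul1r ?mul0r.
Qed.

End rademacher_cube.

Section marginal.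
Context d (T : measurableType d) (R : realType) (P : probability T R).
Local Open Scope ereal_scope.

Lemma ge0_integral_tnth n (i : 'I_n) (G : T -> \bar R) :
  measurable_fun [set: T] G -> (forall x, 0 <= G x) ->
  \int[power_prob P n]_x G (tnth x i) = \int[P]_w G w.
Proof.
move=> mG G0.
have mGt m (j : 'I_m) : measurable_fun [set: m.-tuple T] (fun x => G (tnth x j)).
  by apply: (measurableT_comp mG); exact: measurable_tnth.
elim: n i => [[]//|n IH] i.
rewrite (integral_power_probS P (G := fun x => G (tnth x i)))//.
case: (unliftP ord0 i) => [j ->|->].
  transitivity (\int[P]_x0 cst (\int[P]_w G w) x0).
    by apply: eq_integral => x0 _; under eq_integral do rewrite tnthS; exact: IH.
  by rewrite integral_cst//= [X in _ * X]probability_setT mule1.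
apply: eq_integral => x0 _.
transitivity (\int[power_prob P n]_x cst (G x0) x).
  by apply: eq_integral => x _; rewrite tnth0.
by rewrite integral_cst//= [X in _ * X]probability_setT mule1.
Qed.

Lemma integral_tnth n (i : 'I_n) (f : T -> \bar R) : measurable_fun [set: T] f ->
  \int[power_prob P n]_x f (tnth x i) = \int[P]_w f w.
Proof.
move=> mf; rewrite integralE [RHS]integralE; congr (_ - _).
  rewrite -(ge0_integral_tnth i (measurable_funepos mf) (fun=> funepos_ge0 _ _)).
  by apply: eq_integral => x _; rewrite !funeposE.
rewrite -(ge0_integral_tnth i (measurable_funeneg mf) (fun=> funeneg_ge0 _ _)).
by apply: eq_integral => x _; rewrite !funenegE.
Qed.

Lemma integrable_tnth n (i : 'I_n) (f : T -> \bar R) : P.-integrable [set: T] f ->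
  (power_prob P n).-integrable [set: n.-tuple T] (fun x => f (tnth x i)).
Proof.
move=> /integrableP[mf foo]; apply/integrableP; split.
  by apply: (measurableT_comp mf); exact: measurable_tnth.
by rewrite (ge0_integral_tnth i (G := fun w => `|f w|))//; exact: measurableT_comp.
Qed.

End marginal.

(** * Tilted deviations and switched signs *)

Section tilted.
Context d (Omega : measurableType d) (R : realType) (n : nat).
Hypothesis n_gt0 : (0 < n)%N.
Implicit Types (f : Omega -> R) (x y : n.-tuple Omega).

(** [G] is [gap], or [sym_emp] at given signs once coordinates are switched. *)
Definition tilt (Phi : (Omega -> R) -> n.-tuple Omega -> n.-tuple Omega -> R)
    (G : (Omega -> R) -> n.-tuple Omega -> n.-tuple Omega -> R) (r : R) f x y : R :=
  4 * n%:R * r ^+ 2 * (G f x y - Phi f x y - r ^+ 2 * W f x y).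

Definition gap (s : bool) f x y : R := sign_of_bool R s * (emp_mean f y - emp_mean f x).

(** Switching where the sign differs from s turns the constant sign s of [gap]
into the signs of a ([gap_switch]). *)
Definition switched (s : bool) (a : n.-tuple bool) : {set 'I_n} :=
  [set i | tnth a i != s]%SET.

Lemma gap_switch s a f x y :
  gap s f (switch (switched s a) x y) (switch (switched s a) y x) =
  sym_emp (signs R a) f x y.
Proof.
rewrite /gap /emp_mean /sym_emp -mulrBr mulrCA; congr (_ * _).
rewrite -sumrB mulr_sumr; apply: eq_bigr => i _.
rewrite !tnth_mktuple inE; case: (tnth a i); case: s => /=; ring.
Qed.

Lemma W_switch (I : {set 'I_n}) f x y : W f (switch I x y) (switch I y x) = W f x y.
Proof.
rewrite /W; congr (_ * _); apply: eq_bigr => i _.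
by rewrite !tnth_mktuple; case: ifP => // _; rewrite -sqrrN opprB.
Qed.

Lemma W_ge0 f x y : 0 <= W f x y.
Proof.
by rewrite /W mulr_ge0 ?divr_ge0 ?ler0n// sumr_ge0// => i _; exact: sqr_ge0.
Qed.

Lemma n_neq0 : n%:R != 0 :> R. Proof. by rewrite pnatr_eq0 -lt0n. Qed.

Lemma sym_emp_signs (a : n.-tuple bool) f x y (c : R) :
  sdot (fun i => c * (f (tnth y i) - f (tnth x i))) a =
  c * n%:R * sym_emp (signs R a) f x y.
Proof.
rewrite /sdot /sym_emp -mulrA [n%:R * _]mulrA divff ?n_neq0// mul1r mulr_sumr.
by apply: eq_bigr => i _; rewrite tnth_mktuple mulrCA.
Qed.

(** The tilt is <u, a> - w - |u|^2 for the linear functional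
u_i = 4 r^2 (f (y_i) - f (x_i)) and w = 4 n r^2 Phi, and <u, .> <= w on A. *)
Lemma tilt_le_dist (F : set (Omega -> R)) Phi x y (A : pred (n.-tuple bool)) a (g : R) :
  (forall c, A c -> forall f, F f -> sym_emp (signs R c) f x y <= Phi f x y) ->
  dist_le A a g -> forall f r, F f ->
  tilt Phi (sym_emp (signs R a)) r f x y <= g.
Proof.
move=> AP Dg f r Ff; rewrite /tilt.
have n0 : 0 < n%:R :> R by rewrite ltr0n.
have c0 : 0 <= 4 * r ^+ 2 * n%:R by rewrite mulr_ge0 ?ler0n// mulr_ge0 ?sqr_ge0.
have := Dg (fun i => 4 * r ^+ 2 * (f (tnth y i) - f (tnth x i)))
  (4 * r ^+ 2 * n%:R * Phi f x y).
rewrite sym_emp_signs => H.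
have /H : forall c, A c ->
    sdot (fun i => 4 * r ^+ 2 * (f (tnth y i) - f (tnth x i))) c <= 4 * r ^+ 2 * n%:R * Phi f x y.
  by move=> c Ac; rewrite sym_emp_signs ler_wpM2l// AP.
have -> : \sum_i (4 * r ^+ 2 * (f (tnth y i) - f (tnth x i))) ^+ 2 =
    4 * n%:R * r ^+ 2 * (r ^+ 2 * W f x y).
  rewrite /W; under eq_bigr do rewrite exprMn.
  by rewrite -mulr_sumr; field; rewrite n_neq0.
lra.
Qed.

End tilted.

Section rademacher_bound.
Context d (Omega : measurableType d) (R : realType) (n : nat).
Hypothesis n_gt0 : (0 < n)%N.
Variables (F : set (Omega -> R)) (e : nat -> Omega -> R).
Hypotheses (eF : forall k, F (e k)) (Fe : forall f, F f -> exists k, e k = f).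
Variables (Phi : (Omega -> R) -> n.-tuple Omega -> n.-tuple Omega -> R) (beta : R).
Variables (x y : n.-tuple Omega).
Hypothesis Phi_bound :
  (power_prob (rademacher R) n
     [set eps | 0%E < ereal_sup [set (sym_emp eps f x y - Phi f x y)%:E | f in F]]
     < (1 - beta)%:E)%E.

Definition good : pred (n.-tuple bool) := fun a =>
  `[< forall f, F f -> sym_emp (signs R a) f x y <= Phi f x y >].

Lemma measurable_sym_emp f : measurable_fun [set: n.-tuple R] (fun eps => sym_emp eps f x y).
Proof.
apply: measurable_funM => //; apply: measurable_sum => i.
by apply: measurable_funM => //; exact: measurable_tnth.
Qed.

Lemma measurable_bad_set : measurable
  [set eps : n.-tuple R | (0%E < ereal_sup [set (sym_emp eps f x y - Phi f x y)%:E | f in F])%E].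
Proof.
rewrite (_ : [set _ | _] = \bigcup_k [set eps | 0 < sym_emp eps (e k) x y - Phi (e k) x y]).
  apply: bigcup_measurable => k _.
  rewrite -[X in measurable X]setTI; apply: measurable_fun_ltr => //.
  by apply: measurable_funB => //; exact: measurable_sym_emp.
apply/seteqP; split=> eps /=.
  move/ereal_sup_gt => [_ [f Ff <-]]; have [k <-] := Fe Ff; rewrite lte_fin => h.
  by exists k.
move=> [k _ /= h]; apply: (@lt_le_trans _ _ (sym_emp eps (e k) x y - Phi (e k) x y)%:E).
  by rewrite lte_fin.
by apply: ereal_sup_ubound; exists (e k).
Qed.

Lemma hits_good : beta < hits R good / 2 ^+ n.
Proof.
have N0 : 0 < 2 ^+ n :> R by rewrite exprn_gt0.
have hC : hits R good + hits R (predC good) = 2 ^+ n.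
  rewrite /hits -big_split/= (eq_bigr (fun=> 1)) => [|a _].
    by rewrite sumr_const card_tuple card_bool natrX.
  by case: (good a); rewrite ?addr0 ?add0r.
have : ((hits R (predC good) / 2 ^+ n)%:E < (1 - beta)%:E)%E.
  apply: le_lt_trans Phi_bound.
  apply: hits_le_power_rademacher; first exact: measurable_bad_set.
  move=> a /= /asboolPn/existsNP[f /not_implyP[Ff /negP]]; rewrite -ltNge => h.
  apply: (@lt_le_trans _ _ (sym_emp (signs R a) f x y - Phi f x y)%:E).
    by rewrite lte_fin subr_gt0.
  by apply: ereal_sup_ubound; exists f.
rewrite lte_fin => h.
have : hits R good / 2 ^+ n + hits R (predC good) / 2 ^+ n = 1.
  by rewrite -mulrDl hC divff// gt_eqF.
lra.
Qed.

(** The average over the signs is bounded uniformly in f and r, by the distance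
to the good sign vectors, which form more than a fraction beta of the cube. *)
Lemma tilt_switch_sum (alpha : R) : 0 <= alpha -> 0 < beta ->
  exists2 g : n.-tuple bool -> R,
    (forall a f r, F f -> tilt Phi (sym_emp (signs R a)) r f x y <= g a) &
    \sum_a expR (kappa alpha * g a) <= 2 ^+ n * expR (alpha * ln beta^-1).
Proof.
move=> alpha0 beta0.
have N0 : 0 < 2 ^+ n :> R by rewrite exprn_gt0.
have hg := hits_good.
have h0 : 0 < hits R good by rewrite -(pmulr_lgt0 _ (_ : 0 < (2 ^+ n)^-1)) ?invr_gt0//; lra.
have [g Dg gle] := cube_concentration alpha0 h0.
exists g.
  move=> a f r Ff; by apply: (tilt_le_dist n_gt0 _ (Dg a) r Ff) => c /asboolP.
apply: (le_trans gle); rewrite ler_pM2l// ler_expR lnV ?posrE// mulrN mulNr lerN2.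
by rewrite ler_wpM2l// ler_ln ?posrE ?divr_gt0// ltW.
Qed.

(** Some sign vector is good, and R_n f is bounded below there. *)
Lemma Phi_lower f : 0 < beta -> F f ->
  - (n%:R^-1 * \sum_(i < n) `|f (tnth y i) - f (tnth x i)|) <= Phi f x y.
Proof.
move=> beta0 Ff.
have N0 : 0 < 2 ^+ n :> R by rewrite exprn_gt0.
have hg := hits_good.
have h0 : 0 < hits R good by rewrite -(pmulr_lgt0 _ (_ : 0 < (2 ^+ n)^-1)) ?invr_gt0//; lra.
have [a /asboolP/(_ _ Ff)] := hits_gt0 h0; apply: le_trans.
rewrite /sym_emp -mulrN ler_wpM2l ?invr_ge0// -sumrN ler_sum// => i _.
rewrite tnth_mktuple; have := ler_norm (f (tnth y i) - f (tnth x i)).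
have := ler_normr (f (tnth y i) - f (tnth x i)) (f (tnth y i) - f (tnth x i)).
have := lerNnormlW (lexx `|f (tnth y i) - f (tnth x i)|).
case: (tnth a i) => /=; lra.
Qed.

End rademacher_bound.

(** * The symmetrised exponential moment *)

Section measurability.
Context d (Omega : measurableType d) (R : realType) (n : nat).
Variable f : Omega -> R.
Hypothesis mf : measurable_fun [set: Omega] f.
Local Notation TT := (n.-tuple Omega * n.-tuple Omega)%type.

Lemma measurable_emp_mean : measurable_fun [set: n.-tuple Omega] (emp_mean f).
Proof.
apply: measurable_funM => //; apply: measurable_sum => i.
by apply: (measurableT_comp mf); exact: measurable_tnth.
Qed.

Lemma measurable_gap s : measurable_fun [set: TT] (fun z => gap s f z.1 z.2).
Proof.
apply: measurable_funM => //; apply: measurable_funB;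
  by apply: (measurableT_comp measurable_emp_mean).
Qed.

Lemma measurable_W : measurable_fun [set: TT] (fun z => W f z.1 z.2).
Proof.
apply: measurable_funM => //; apply: measurable_sum => i.
apply: measurable_funX; apply: measurable_funB; apply: (measurableT_comp mf);
  by apply: (measurableT_comp (f := fun x : n.-tuple Omega => tnth x i)) => //; exact: measurable_tnth.
Qed.

Lemma measurable_tilt Phi s r :
  measurable_fun [set: TT] (fun z => Phi f z.1 z.2) ->
  measurable_fun [set: TT] (fun z => tilt Phi (gap s) r f z.1 z.2).
Proof.
move=> mPhi; apply: measurable_funM => //; apply: measurable_funB.
  by apply: measurable_funB => //; exact: measurable_gap.
by apply: measurable_funM => //; exact: measurable_W.
Qed.

End measurability.

Section score.
Context d (Omega : measurableType d) (R : realType) (P : probability Omega R) (n : nat).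
Hypothesis n_gt0 : (0 < n)%N.
Variables (F : set (Omega -> R)) (e : nat -> Omega -> R).
Hypotheses (eF : forall k, F (e k)) (Fe : forall f, F f -> exists k, e k = f).
Hypothesis mF : forall f, F f -> measurable_fun [set: Omega] f.
Variables (Phi : (Omega -> R) -> n.-tuple Omega -> n.-tuple Omega -> R) (beta : R).
Hypothesis beta0 : 0 < beta.
Hypothesis mPhi : forall f, F f ->
  measurable_fun [set: n.-tuple Omega * n.-tuple Omega] (fun z => Phi f z.1 z.2).
Hypothesis Phi_invariant : forall f, F f -> forall (I : {set 'I_n}) x y,
      Phi f (switch I x y) (switch I y x) = Phi f x y.
Hypothesis Phi_bound : forall x y : n.-tuple Omega,
      (power_prob (rademacher R) n
         [set eps | 0%E < ereal_sup [set (sym_emp eps f x y - Phi f x y)%:E | f in F]]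
       < (1 - beta)%:E)%E.
Variables (alpha : R) (s : bool).
Hypothesis alpha0 : 0 <= alpha.
Local Open Scope ereal_scope.

(** An enumeration of the pairs of an index into the class and a rational
parameter; it makes [score] a countable supremum. *)
Definition candidate (k : nat) : nat * rat := odflt (0%N, 0%Q) (unpickle k).

Definition score (z : n.-tuple Omega * n.-tuple Omega) : \bar R :=
  ereal_sup (range (fun k => (expR (kappa alpha *
    tilt Phi (gap s) (ratr (candidate k).2) (e (candidate k).1) z.1 z.2))%:E)).

Lemma measurable_score : measurable_fun [set: n.-tuple Omega * n.-tuple Omega] score.
Proof.
pose u z k := (expR (kappa alpha *
    tilt Phi (gap s) (ratr (candidate k).2) (e (candidate k).1) z.1 z.2))%:E.
rewrite (_ : score = fun z => esups (u z) 0%N).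
  apply: measurable_fun_esups => k; apply/measurable_EFinP.
  apply: (measurableT_comp (@measurable_expR R)); apply: measurable_funM => //.
  exact: (measurable_tilt (mF (eF _)) _ _ (mPhi (eF _))).
apply/funext => z; rewrite /score /esups/= /sdrop; congr ereal_sup.
by apply/seteqP; split=> [_ [k _ <-]|_ [k _ <-]]; exists k.
Qed.

Lemma le_score f (r : rat) x y : F f ->
  (expR (kappa alpha * tilt Phi (gap s) (ratr r) f x y))%:E <= score (x, y).
Proof.
move=> /Fe[k <-]; apply: ereal_sup_ubound; exists (pickle (k, r)) => //.
by rewrite /candidate pickleK.
Qed.

Lemma score_ge0 z : 0 <= score z.
Proof.
by apply: le_trans (le_score 0%Q z.1 z.2 (eF 0%N)); rewrite lee_fin expR_ge0.
Qed.

Lemma sum_score_switch x y :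
  \sum_(a : n.-tuple bool)
    score (switch (switched s a) x y, switch (switched s a) y x) <=
  (2 ^+ n * expR (alpha * ln beta^-1))%:E.
Proof.
have [g Hg gle] := tilt_switch_sum n_gt0 eF Fe (Phi_bound x y) alpha0 beta0.
apply: (@le_trans _ _ (\sum_(a : n.-tuple bool) (expR (kappa alpha * g a))%:E)).
  apply: lee_sum => a _; apply: ge_ereal_sup => _ [k _ <-] /=.
  rewrite lee_fin ler_expR; apply: ler_wpM2l.
    by rewrite /kappa divr_ge0// addr_ge0.
  rewrite /tilt gap_switch W_switch (Phi_invariant (eF _)).
  exact: Hg.
by rewrite sumEFin lee_fin.
Qed.

Lemma integral_score_le :
  \int[power_prob P n]_x \int[power_prob P n]_y score (x, y) <=
  (expR (alpha * ln beta^-1))%:E.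
Proof.
set mu := power_prob P n.
set I := \int[mu]_x \int[mu]_y score (x, y).
pose sc a z := score (switch (switched s a) z.1 z.2, switch (switched s a) z.2 z.1).
have msc a : measurable_fun [set: n.-tuple Omega * n.-tuple Omega] (sc a).
  exact: (measurableT_comp measurable_score (measurable_switch_pair (switched s a))).
have sc0 a z : 0 <= sc a z by exact: score_ge0.
have sumI : \sum_(a : n.-tuple bool) I = \int[mu]_x \int[mu]_y \sum_a sc a (x, y).
  transitivity (\sum_a \int[mu]_x \int[mu]_y sc a (x, y)).
    apply: eq_bigr => a _.
    exact: (esym (integral_switch P (switched s a) measurable_score score_ge0)).
  rewrite -ge0_integral_sum//.
  - apply: eq_integral => x _; rewrite -ge0_integral_sum// => a.
    exact: (measurable_fun_pair2 x (msc a)).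
  - by move=> a; exact: (measurable_fun_fubini_tonelli_F _ (msc a) (sc0 a)).
  - by move=> a x _; apply: integral_ge0.
have I0 : 0 <= I by apply: integral_ge0 => x _; apply: integral_ge0 => y _; exact: score_ge0.
have N0 : (0 < 2 ^+ n :> R)%R by rewrite exprn_gt0.
have mu1 : mu [set: n.-tuple Omega] = 1 by exact: probability_setT.
have : \sum_(a : n.-tuple bool) I <= (2 ^+ n * expR (alpha * ln beta^-1))%:E.
  rewrite sumI.
  set c := (2 ^+ n * _)%R.
  have cst_int : \int[mu]_x (cst c%:E x) = c%:E by rewrite integral_cst// [X in _ * X]mu1 mule1.
  have mS : measurable_fun [set: n.-tuple Omega * n.-tuple Omega] (fun z => \sum_a sc a z).
    by apply: emeasurable_sum => a; exact: msc.
  have S0 z : 0 <= \sum_a sc a z by apply: sume_ge0 => a _.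
  have c0 : (0 <= c)%R by rewrite mulr_ge0 ?expR_ge0// ltW.
  rewrite -cst_int; apply: ge0_le_integral => //.
  - by move=> x _; apply: integral_ge0.
  - exact: (measurable_fun_fubini_tonelli_F _ mS S0).
  - move=> x _; rewrite -[leRHS]cst_int; apply: ge0_le_integral => //.
    + exact: (measurable_fun_pair2 x mS).
    + by move=> y _; exact: sum_score_switch.
have -> : \sum_(a : n.-tuple bool) I = (2 ^+ n)%:E * I.
  rewrite (eq_bigr (fun=> 1%:E * I)) => [|a _]; last by rewrite mul1e.
  by rewrite -ge0_sume_distrl// sumEFin sumr_const card_tuple card_bool natrX.
rewrite EFinM.
by rewrite lee_pmul2l// lte_fin.
Qed.

End score.

(** * Means, Jensen's inequality and integrability *)

Section prob_integrals.
Context d (T : measurableType d) (R : realType) (mu : probability T R).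
Local Open Scope ereal_scope.

Definition has_mean (X : T -> R) (m : R) : Prop :=
  mu.-integrable [set: T] (EFin \o X) /\ \int[mu]_y (X y)%:E = m%:E.

Lemma has_mean_cst c : has_mean (fun=> c) c.
Proof.
split; first exact: finite_measure_integrable_cst.
by rewrite integral_cst// [X in _ * X]probability_setT mule1.
Qed.

Lemma has_meanZ X m k : has_mean X m -> has_mean (fun y => k * X y)%R (k * m)%R.
Proof.
move=> [iX Xm]; split.
  rewrite (_ : _ \o _ = fun y => k%:E * (EFin \o X) y); first exact: integrableZl.
  by apply/funext => y; rewrite /= EFinM.
by under eq_integral do rewrite EFinM; rewrite integralZl// Xm -EFinM.
Qed.

Lemma has_meanD X Y m p : has_mean X m -> has_mean Y p ->
  has_mean (fun y => X y + Y y)%R (m + p)%R.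
Proof.
move=> [iX Xm] [iY Yp]; split.
  rewrite (_ : _ \o _ = (EFin \o X) \+ (EFin \o Y)); first exact: integrableD.
  by apply/funext => y; rewrite /= EFinD.
by under eq_integral do rewrite EFinD; rewrite integralD// Xm Yp -EFinD.
Qed.

Lemma has_meanB X Y m p : has_mean X m -> has_mean Y p ->
  has_mean (fun y => X y - Y y)%R (m - p)%R.
Proof.
move=> hX /(has_meanZ (-1)) hY; have := has_meanD hX hY; rewrite mulN1r.
by under eq_fun do rewrite mulN1r.
Qed.

Lemma has_mean_sum n (X : 'I_n -> T -> R) (m : 'I_n -> R) :
  (forall i, has_mean (X i) (m i)) ->
  has_mean (fun y => \sum_i X i y)%R (\sum_i m i)%R.
Proof.
elim: n X m => [|n IH] X m hX.
  by under eq_fun do rewrite big_ord0; rewrite big_ord0; exact: has_mean_cst.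
by under eq_fun do rewrite big_ord_recl; rewrite big_ord_recl; apply: has_meanD => //; exact: IH.
Qed.

Lemma integrable_has_mean (X : T -> R) :
  mu.-integrable [set: T] (EFin \o X) -> has_mean X (\int[mu]_y X y)%R.
Proof. by move=> iX; split=> //; rewrite /Rintegral fineK//; exact: integrable_fin_num. Qed.

Lemma has_mean_norm X m : has_mean X m -> exists p, has_mean (fun y => `|X y|%R) p.
Proof.
move=> [iX _]; exists (\int[mu]_y `|X y|)%R; apply: integrable_has_mean.
exact: (integrable_abse iX).
Qed.

(** Jensen's inequality for the exponential, by integration of its tangent at
the mean; the right side may be infinite. *)
Lemma le_expR_integral (X : T -> R) (m : R) : has_mean X m ->
  (expR m)%:E <= \int[mu]_y (expR (X y))%:E.
Proof.
move=> [iX Xm].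
have mX : measurable_fun [set: T] X by apply/measurable_EFinP; exact: measurable_int iX.
have meX : measurable_fun [set: T] (fun y => (expR (X y))%:E).
  by apply/measurable_EFinP; exact: (measurableT_comp (@measurable_expR R)).
have [eoo|eoo] := eqVneq (\int[mu]_y (expR (X y))%:E) +oo; first by rewrite eoo leey.
have ieX : mu.-integrable [set: T] (fun y => (expR (X y))%:E).
  apply/integrableP; split => //.
  under eq_integral do rewrite gee0_abs ?lee_fin ?expR_ge0//.
  by rewrite ltey.
pose c := (expR m * (1 - m))%R.
have [icst _] := has_mean_cst c.
have iZ : mu.-integrable [set: T] (fun y => (expR m)%:E * (X y)%:E).
  exact: integrableZl.
have -> : (expR m)%:E = \int[mu]_y ((expR m)%:E * (X y)%:E + cst c%:E y).
  rewrite integralD// integralZl// Xm integral_cst// [X in _ + _ * X]probability_setT mule1.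
  by rewrite -EFinM -EFinD /c; congr EFin; ring.
apply: le_integral => //; first exact: integrableD.
move=> y _; rewrite /= -EFinM -EFinD lee_fin /c.
have -> : (expR (X y) = expR m * expR (X y - m))%R by rewrite -expRD addrC subrK.
rewrite -mulrDr ler_pM2l ?expR_gt0//; apply: le_trans (expR_ge1Dx _); lra.
Qed.

Lemma integral_funeneg_fin_num (X Y : T -> R) : measurable_fun [set: T] X ->
  mu.-integrable [set: T] (EFin \o Y) -> (forall y, Y y <= X y)%R ->
  \int[mu]_y ((EFin \o X)^\- y) \is a fin_num.
Proof.
move=> mX iY YX.
rewrite ge0_fin_numE; last by apply: integral_ge0 => y _; exact: funeneg_ge0.
have /integrableP[mY Yoo] := iY.
apply: le_lt_trans Yoo; apply: ge0_le_integral => //.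
- by apply: measurable_funeneg; exact/measurable_EFinP.
- exact: measurableT_comp.
- move=> y _; rewrite funenegE /= -EFin_max lee_fin ge_max normr_ge0 andbT.
  by rewrite (@le_trans _ _ (- Y y)%R) ?lerN2// -normrN ler_norm.
Qed.

(** The negative part is dominated by that of Y, hence has a finite integral,
and then the integral of X is infinite unless that of the positive part is
finite. *)
Lemma integrable_of_lower (X Y : T -> R) : measurable_fun [set: T] X ->
  mu.-integrable [set: T] (EFin \o Y) -> (forall y, Y y <= X y)%R ->
  \int[mu]_y (X y)%:E < +oo -> mu.-integrable [set: T] (EFin \o X).
Proof.
move=> mX iY YX Xoo.
have mXe : measurable_fun [set: T] (EFin \o X) by exact/measurable_EFinP.
have Nfin := integral_funeneg_fin_num mX iY YX.
have Pfin : \int[mu]_y ((EFin \o X)^\+ y) < +oo.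
  have : \int[mu]_y (EFin \o X) y < +oo := Xoo.
  rewrite integralE; move: Nfin; set N := \int[mu]_y _ => Nfin.
  rewrite -(fineK Nfin); case: (\int[mu]_y _) => [r _| |//]; first exact: ltry.
  by rewrite -EFinN addye.
apply/integrableP; split => //.
rewrite (_ : \int[mu]_y _ = \int[mu]_y ((EFin \o X)^\+ y + (EFin \o X)^\- y)).
  rewrite ge0_integralD//; [|exact: measurable_funepos|exact: measurable_funeneg].
  by rewrite lte_add_pinfty// ltey_eq Nfin.
by apply: eq_integral => y _; rewrite -/((abse \o (EFin \o X)) y) fune_abse.
Qed.

End prob_integrals.

Section tilted_means.
Context d (Omega : measurableType d) (R : realType) (P : probability Omega R) (n : nat).
Hypothesis n_gt0 : (0 < n)%N.
Local Notation mu := (power_prob P n).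

Lemma has_mean_tnth (f : Omega -> R) m (i : 'I_n) :
  has_mean P f m -> has_mean mu (fun y => f (tnth y i)) m.
Proof.
move=> [iF Fm]; split; first exact: (integrable_tnth i iF).
by rewrite -Fm; apply: (integral_tnth P i (f := EFin \o f)); exact: measurable_int iF.
Qed.

Lemma has_mean_emp_mean (f : Omega -> R) m : has_mean P f m -> has_mean mu (emp_mean f) m.
Proof.
move=> hf; have := has_mean_sum (fun i => has_mean_tnth i hf).
by move/(has_meanZ (n%:R^-1)); rewrite sumr_const card_ord -[m *+ n]mulr_natl mulKf// pnatr_eq0 -lt0n.
Qed.

Lemma has_mean_tilt Phi s r (f : Omega -> R) x (m p v : R) :
  has_mean P f m -> has_mean mu (Phi f x) p -> has_mean mu (W f x) v ->
  has_mean mu (tilt Phi (gap s) r f x)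
    (4 * n%:R * r ^+ 2 * (sign_of_bool R s * (m - emp_mean f x) - p - r ^+ 2 * v)).
Proof.
move=> hf hPhi hW; apply: has_meanZ; apply: has_meanB; last exact: has_meanZ.
apply: has_meanB => //; apply: has_meanZ; apply: has_meanB; last exact: has_mean_cst.
exact: has_mean_emp_mean.
Qed.

End tilted_means.

(** * Eliminating the square root *)

Section optimisation.
Context (R : realType).
Implicit Types (k q v t C : R).

Lemma rational_to_real (h : R -> R) C : continuous h ->
  (forall r : rat, h (ratr r) <= C) -> forall r, h r <= C.
Proof.
move=> ch hC r; rewrite leNgt; apply/negP => Cr.
have oU : open [set r | C < h r].
  rewrite (_ : [set r | C < h r] = h @^-1` [set` `]C, +oo[]); last first.
    by apply/seteqP; split=> z /=; rewrite in_itv/= andbT.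
  by apply: open_comp => //; exact: interval_open.
have [w [/= Cw [z _ zE]]] := dense_rat (ex_intro _ r Cr : [set r | C < h r] !=set0) oU.
by move: Cw; rewrite -zE ltNge hC.
Qed.

(** The parameter r^2 = q / (2 v) maximises the quadratic, with value n q^2 / v.
If v = 0, the exponent is linear in r^2 with positive slope, and r is chosen so
that it equals t. *)
Lemma optimal_tilt (n : R) k q v t C : 0 < n -> 0 <= k -> 0 < t -> 0 <= v ->
  Num.sqrt (v * (t / n)) <= q -> (v = 0 -> 0 < q) ->
  (forall r : rat, expR (k * (4 * n * ratr r ^+ 2 * (q - ratr r ^+ 2 * v))) <= C) ->
  expR (k * t) <= C.
Proof.
move=> n0 k0 t0 v0 vq v0q hq.
pose g (r : R) := k * (4 * n * r ^+ 2 * (q - r ^+ 2 * v)).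
have cg : continuous g.
  move=> z; apply: cvgM; first exact: cvg_cst.
  apply: cvgM; first by apply: cvgM; [exact: cvg_cst|exact: exprn_continuous].
  apply: cvgB; first exact: cvg_cst.
  by apply: cvgM; [exact: exprn_continuous|exact: cvg_cst].
have H r : expR (g r) <= C.
  apply: (rational_to_real (h := expR \o g)) => // z.
  by apply: continuous_comp; [exact: cg|exact: continuous_expR].
rewrite /g {g cg} in H.
have [vE0|vn0] := eqVneq v 0.
  have q0 := v0q vE0.
  apply: le_trans (H (Num.sqrt (t / (4 * n * q)))).
  rewrite vE0 mulr0 subr0 sqr_sqrtr; last by rewrite divr_ge0 ?mulr_ge0 ?ltW.
  rewrite ler_expR ler_wpM2l//.
  have -> : 4 * n * (t / (4 * n * q)) * q = t by field; rewrite !gt_eqF.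
  exact: lexx.
have vp : 0 < v by rewrite lt_def vn0.
have tn0 : 0 < t / n by rewrite divr_gt0.
have q0 : 0 < q by apply: lt_le_trans vq; rewrite sqrtr_gt0 mulr_gt0.
apply: le_trans (H (Num.sqrt (q / (2 * v)))).
rewrite sqr_sqrtr; last by rewrite divr_ge0 ?mulr_ge0 ?ltW.
rewrite ler_expR ler_wpM2l//.
have -> : 4 * n * (q / (2 * v)) * (q - q / (2 * v) * v) = q ^+ 2 * (n / v).
  by field; rewrite gt_eqF.
have vtn0 : 0 <= v * (t / n) by rewrite mulr_ge0 ?ltW.
have : v * (t / n) <= q ^+ 2.
  by rewrite -(sqr_sqrtr vtn0) ler_sqr ?nnegrE ?sqrtr_ge0// ltW.
have nv0 : 0 <= n / v by rewrite divr_ge0 ?ltW.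
move=> /(ler_wpM2r nv0) h; apply: le_trans h.
have -> : v * (t / n) * (n / v) = t by field; rewrite !gt_eqF.
exact: lexx.
Qed.

End optimisation.

(** * From a deviation to an exponential moment *)

Section event.
Context d (Omega : measurableType d) (R : realType) (P : probability Omega R) (n : nat).
Hypothesis n_gt0 : (0 < n)%N.
Variables (F : set (Omega -> R)) (e : nat -> Omega -> R).
Hypotheses (eF : forall k, F (e k)) (Fe : forall f, F f -> exists k, e k = f).
Hypothesis F_integrable : forall f, F f -> P.-integrable [set: Omega] (EFin \o f).
Variables (Phi : (Omega -> R) -> n.-tuple Omega -> n.-tuple Omega -> R) (beta : R).
Hypothesis beta0 : 0 < beta.
Hypothesis mPhi : forall f, F f ->
  measurable_fun [set: n.-tuple Omega * n.-tuple Omega] (fun z => Phi f z.1 z.2).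
Hypothesis Phi_bound : forall x y : n.-tuple Omega,
      (power_prob (rademacher R) n
         [set eps | 0%E < ereal_sup [set (sym_emp eps f x y - Phi f x y)%:E | f in F]]
       < (1 - beta)%:E)%E.
Variables (alpha : R) (s : bool).
Hypothesis alpha0 : 0 <= alpha.
Local Open Scope ereal_scope.
Local Notation mu := (power_prob P n).

Let mF f : F f -> measurable_fun [set: Omega] f.
Proof. by move=> Ff; apply/measurable_EFinP; exact: measurable_int (F_integrable Ff). Qed.

(** Through [integrable_of_lower], this gives a meaning to E_y Phi: it is either
finite or +oo. *)
Lemma Phi_integrable_lower f x : F f -> exists2 Y : n.-tuple Omega -> R,
  mu.-integrable [set: n.-tuple Omega] (EFin \o Y) & forall y, (Y y <= Phi f x y)%R.
Proof.
move=> Ff.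
exists (fun y => - (n%:R^-1 * \sum_(i < n) `|f (tnth y i) - f (tnth x i)|))%R; last first.
  by move=> y; exact: (Phi_lower eF Fe (Phi_bound x y) beta0 Ff).
have hf := integrable_has_mean (F_integrable Ff).
have hm i : exists m, has_mean mu (fun y => `|f (tnth y i) - f (tnth x i)|%R) m.
  apply: has_mean_norm.
  exact: (has_meanB (has_mean_tnth i hf) (has_mean_cst _ _)).
have := has_meanZ (-1) (has_meanZ (n%:R^-1) (has_mean_sum (fun i => svalP (cid (hm i))))).
by under eq_fun do rewrite mulN1r; case.
Qed.

Lemma deviation_le_score t f x : (0 < t)%R -> F f ->
  let q := (sign_of_bool R s * (mean P f - emp_mean f x))%R in
  deviation_bound P Phi t f x <= q%:E ->
  (V P f x = 0 -> deviation_bound P Phi t f x < q%:E) ->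
  (expR (kappa alpha * t))%:E <= \int[mu]_y score e Phi alpha s (x, y).
Proof.
move=> t0 Ff q; rewrite /deviation_bound /V unlock => devq V0q.
have n0 : (0 < n%:R :> R)%R by rewrite ltr0n.
have tn0 : (0 < t / n%:R :> R)%R by rewrite divr_gt0.
have mPx : measurable_fun [set: n.-tuple Omega] (Phi f x).
  exact: (measurable_fun_pair2 x (mPhi Ff)).
have mWx : measurable_fun [set: n.-tuple Omega] (W f x).
  exact: (measurable_fun_pair2 x (measurable_W (mF Ff))).
have W0 y : (0 <= W f x y)%R by exact: W_ge0.
have [Y iY YPhi] := Phi_integrable_lower x Ff.
(* Neither term of the bound is -oo, and their sum is at most a real number. *)
set sq := sqrte _ in devq V0q.
have sq0 : 0 <= sq by exact: sqrte_ge0.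
have Phioo : \int[mu]_y (Phi f x y)%:E < +oo.
  rewrite ltey; apply/eqP => PhiE; move: devq; rewrite PhiE addye ?leye_eq//.
  by rewrite gt_eqF// (lt_le_trans _ sq0).
have iPhi := integrable_of_lower mPx iY YPhi Phioo.
have hPhi := integrable_has_mean iPhi.
set p := (\int[mu]_y Phi f x y)%R in hPhi.
have [_ PhiE] := hPhi.
have Woo : \int[mu]_y (W f x y)%:E < +oo.
  by rewrite ltey; apply/eqP => WE; move: devq; rewrite /sq WE PhiE gt0_mulye ?lte_fin//.
have iW : mu.-integrable [set: n.-tuple Omega] (EFin \o W f x).
  apply/integrableP; split; first exact/measurable_EFinP.
  by under eq_integral do rewrite /= ger0_norm//.
have hW := integrable_has_mean iW.
set v := (\int[mu]_y W f x y)%R in hW.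
have [_ WE] := hW.
have v0 : (0 <= v)%R.
  by rewrite -lee_fin -WE; apply: integral_ge0 => y _; rewrite lee_fin.
have sqE : sq = (Num.sqrt (v * (t / n%:R)))%:E by rewrite /sq WE.
rewrite PhiE sqE -EFinD lee_fin in devq.
have {}V0q : v = 0%R -> (0 < q - p)%R.
  move=> vE0; rewrite PhiE sqE WE vE0 mul0r sqrtr0 adde0 lte_fin in V0q.
  by rewrite subr_gt0; exact: V0q.
have hf := integrable_has_mean (F_integrable Ff).
have ms := measurable_score eF mF mPhi alpha s.
have s0 := score_ge0 eF Fe Phi alpha s.
have tilt_le (r : rat) : (expR (kappa alpha *
    (4 * n%:R * ratr r ^+ 2 * ((q - p) - ratr r ^+ 2 * v))))%:E <=
    \int[mu]_y score e Phi alpha s (x, y).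
  have hT := has_meanZ (kappa alpha) (has_mean_tilt n_gt0 s (ratr r) hf hPhi hW).
  apply: (le_trans (le_expR_integral hT)); apply: ge0_le_integral => //.
  - apply/measurable_EFinP.
    apply: (measurableT_comp (@measurable_expR R)).
    by apply/measurable_EFinP; exact: measurable_int (proj1 hT).
  - exact: (measurable_fun_pair2 x ms).
  - by move=> y _; exact: (le_score Fe Phi alpha s r x y Ff).
move: tilt_le; set I := \int[mu]_y _ => tilt_le.
have I0 : 0 <= I by apply: integral_ge0.
move: I I0 tilt_le => [C| |]// _ tilt_le; last by rewrite leey.
rewrite lee_fin; apply: (optimal_tilt (n := n%:R) (q := q - p) (v := v)) => //.
- by rewrite /kappa divr_ge0// addr_ge0.
- by rewrite lerBrDl.
Qed.

End event.

(** * Measurability of the event and conclusion *)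

Section event_measurability.
Context d (Omega : measurableType d) (R : realType) (P : probability Omega R) (n : nat).
Variables (f : Omega -> R) (Phi : (Omega -> R) -> n.-tuple Omega -> n.-tuple Omega -> R).
Hypothesis mf : measurable_fun [set: Omega] f.
Hypothesis mPhi : measurable_fun [set: n.-tuple Omega * n.-tuple Omega]
        (fun z => Phi f z.1 z.2).
Local Open Scope ereal_scope.
Local Notation mu := (power_prob P n).

(** The expectation of a signed function is the difference of two nonnegative
integrals, each measurable by Tonelli's theorem. *)
Lemma measurable_expectation_section (h : n.-tuple Omega -> n.-tuple Omega -> R) :
  measurable_fun [set: n.-tuple Omega * n.-tuple Omega] (fun z => h z.1 z.2) ->
  measurable_fun [set: n.-tuple Omega] (fun x => 'E_mu[h x]).
Proof.
move=> mh; have /measurable_EFinP mhe := mh.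
pose H (z : n.-tuple Omega * n.-tuple Omega) := (h z.1 z.2)%:E.
rewrite (_ : (fun x => 'E_mu[h x]) =
  fun x => \int[mu]_y H^\+ (x, y) - \int[mu]_y H^\- (x, y)); last first.
  apply/funext => x; rewrite unlock [LHS]integralE; congr (_ - _).
    by apply: eq_integral => y _; rewrite !funeposE.
  by apply: eq_integral => y _; rewrite !funenegE.
apply: emeasurable_funB.
- by apply: (measurable_fun_fubini_tonelli_F (H^\+)) => //; exact: measurable_funepos.
- by apply: (measurable_fun_fubini_tonelli_F (H^\-)) => //; exact: measurable_funeneg.
Qed.

Lemma measurable_V : measurable_fun [set: n.-tuple Omega] (V P f).
Proof. exact: (measurable_expectation_section (measurable_W mf)). Qed.

Lemma V_ge0 (x : n.-tuple Omega) : 0 <= V P f x.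
Proof.
by rewrite /V unlock; apply: integral_ge0 => y _; rewrite lee_fin W_ge0.
Qed.

Lemma measurable_deviation_bound (t : R) : (0 <= t)%R ->
  measurable_fun [set: n.-tuple Omega] (deviation_bound P Phi t f).
Proof.
move=> t0; apply: emeasurable_funD; first exact: (measurable_expectation_section mPhi).
rewrite (_ : (fun x => _) = (fun x => (V P f x * (t / n%:R)%:E) `^ 2^-1)).
  apply: (measurableT_comp (@measurable_poweR R _)).
  by apply: emeasurable_funM => //; exact: measurable_V.
apply/funext => x; rewrite poweR12_sqrt// mule_ge0 ?V_ge0// lee_fin divr_ge0//.
Qed.

Lemma measurable_deviation_event (t : R) (Q : n.-tuple Omega -> R) : (0 <= t)%R ->
  measurable_fun [set: n.-tuple Omega] Q ->
  measurable [set x | deviation_bound P Phi t f x <= (Q x)%:E /\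
    (V P f x = 0 -> deviation_bound P Phi t f x < (Q x)%:E)].
Proof.
move=> t0 mQ.
have mD := measurable_deviation_bound t0.
have mQe : measurable_fun [set: n.-tuple Omega] (fun x => (Q x)%:E) by exact/measurable_EFinP.
rewrite (_ : [set x | _] = [set x | deviation_bound P Phi t f x <= (Q x)%:E] `&`
  (~` [set x | V P f x = 0] `|` [set x | deviation_bound P Phi t f x < (Q x)%:E])).
  apply: measurableI; first by rewrite -[X in measurable X]setTI; exact: measurable_lee.
  apply: measurableU; last by rewrite -[X in measurable X]setTI; exact: measurable_lte.
  apply: measurableC; rewrite -[X in measurable X]setTI; apply: measurable_eqe => //.
  exact: measurable_V.
apply/seteqP; split=> x /= [h1 h2]; split=> //.
  by have [/h2|] := pselect (V P f x = 0); [right|left].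
by case: h2.
Qed.

End event_measurability.

(** This alpha minimises alpha L - t alpha / (alpha + 1); it is nonnegative
exactly because L <= t. *)
Lemma optimal_exponent (R : realType) (t L : R) : 0 < L -> L <= t ->
  let alpha := Num.sqrt t / Num.sqrt L - 1 in
  0 <= alpha /\ alpha * L - kappa alpha * t = - (Num.sqrt t - Num.sqrt L) ^+ 2.
Proof.
move=> L0 Lt alpha.
have t0 : 0 < t by exact: lt_le_trans Lt.
have sL : 0 < Num.sqrt L by rewrite sqrtr_gt0.
have st : 0 < Num.sqrt t by rewrite sqrtr_gt0.
split; first by rewrite subr_ge0 ler_pdivlMr// mul1r ler_wsqrtr.
have -> : alpha * L - kappa alpha * t =
    alpha * Num.sqrt L ^+ 2 - kappa alpha * Num.sqrt t ^+ 2.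
  by rewrite !sqr_sqrtr// ltW.
by rewrite /kappa /alpha subrK; field; rewrite !gt_eqF.
Qed.

Theorem theorem2 (d : measure_display) (Omega : measurableType d) (R : realType)
    (P : probability Omega R) (n : nat) (n_gt0 : (0 < n)%N)
    (F : set (Omega -> R)) (F_countable : countable F)
    (F_integrable : forall f, F f -> P.-integrable [set: Omega] (EFin \o f))
    (beta : R) (beta01 : 0 < beta < 1)
    (Phi : (Omega -> R) -> n.-tuple Omega -> n.-tuple Omega -> R)
    (Phi_measurable : forall f, F f ->
      measurable_fun [set: n.-tuple Omega * n.-tuple Omega]
        (fun z => Phi f z.1 z.2))
    (Phi_invariant : forall f, F f -> forall (I : {set 'I_n}) x y,
      Phi f (switch I x y) (switch I y x) = Phi f x y)
    (Phi_bound : forall x y : n.-tuple Omega,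
      (power_prob (rademacher R) n
         [set eps | 0%E < ereal_sup [set (sym_emp eps f x y - Phi f x y)%:E | f in F]]
       < (1 - beta)%:E)%E)
    (Q : (Omega -> R) -> n.-tuple Omega -> R)
    (Q_def : Q = (fun f x => mean P f - emp_mean f x) \/
             Q = (fun f x => emp_mean f x - mean P f))
    (t : R) (t_ge : ln beta^-1 <= t) :
  (power_prob P n
     [set x | exists f, [/\ F f,
        deviation_bound P Phi t f x <= (Q f x)%:E &
        (* V f x = 0 forces Q f x = 0 and a nonnegative bound, so the only event
           removed here is the equality 0 = 0, for which the estimate fails:
           take F = {0} and Phi = 0 *)
        V P f x = 0 -> deviation_bound P Phi t f x < (Q f x)%:E]]
   <= (expR (1 - (Num.sqrt t - Num.sqrt (ln beta^-1)) ^+ 2))%:E)%E.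
Proof.
have /andP[beta0 beta1] := beta01.
have L0 : 0 < ln beta^-1 by rewrite ln_gt0// invf_gt1.
have t0 : 0 < t by exact: lt_le_trans t_ge.
have [alpha0 exponent] := optimal_exponent L0 t_ge.
set alpha := Num.sqrt t / _ - 1 in alpha0 exponent.
set event := [set x | _].
move/pfcard_geP : F_countable => [F0|[e]].
  by rewrite (_ : event = set0) ?measure0 ?lee_fin ?expR_ge0//;
    apply/seteqP; split=> x // [f []]; rewrite F0.
have eF k : F (e k) by exact: (@funS _ _ _ _ e).
have Fe f : F f -> exists k, e k = f.
  by move=> /(@surj _ _ _ _ e)[k _ <-]; exists k.
have mF f : F f -> measurable_fun [set: Omega] f.
  by move=> Ff; apply/measurable_EFinP; exact: measurable_int (F_integrable _ Ff).
(* The sign s tells the two cases of Q apart. *)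
have [s QE] : exists s, Q = fun f x => sign_of_bool R s * (mean P f - emp_mean f x).
  case: Q_def => ->; [exists true|exists false]; apply/funext => f; apply/funext => x /=;
    by ring.
have mevent : measurable event.
  rewrite (_ : event = \bigcup_k [set x |
      (deviation_bound P Phi t (e k) x <= (Q (e k) x)%:E)%E /\
      (V P (e k) x = 0%E -> (deviation_bound P Phi t (e k) x < (Q (e k) x)%:E)%E)]).
    apply: bigcup_measurable => k _.
    apply: measurable_deviation_event; [exact: mF|exact: Phi_measurable|exact: ltW|].
    rewrite QE; apply: measurable_funM => //; apply: measurable_funB => //.
    exact: measurable_emp_mean (mF _ (eF k)).
  apply/seteqP; split=> x [].
    by move=> f [/Fe[k <-] h1 h2]; exists k.
  by move=> k _ [h1 h2]; exists (e k).
pose G x := (\int[power_prob P n]_y score e Phi alpha s (x, y))%E.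
have mscore := measurable_score eF mF Phi_measurable alpha s.
have score0 := score_ge0 eF Fe Phi alpha s.
have mG : measurable_fun [set: n.-tuple Omega] G.
  exact: (measurable_fun_fubini_tonelli_F _ mscore score0).
have G0 x : (0 <= G x)%E by apply: integral_ge0.
have eventG x : event x -> ((expR (kappa alpha * t))%:E <= G x)%E.
  move=> [f [Ff h1 h2]].
  apply: (deviation_le_score n_gt0 eF Fe F_integrable beta0 Phi_measurable Phi_bound
    alpha0 t0 Ff); by [move: h1; rewrite QE|move: h2; rewrite QE].
have markov : ((expR (kappa alpha * t))%:E * power_prob P n event <=
    \int[power_prob P n]_x G x)%E.
  have := le_integral_abse (power_prob P n) measurableT mG (expR_gt0 (kappa alpha * t)).
  under [in X in (_ <= X)%E -> _]eq_integral do rewrite gee0_abs//.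
  apply: le_trans; rewrite lee_pmul2l// ?lte_fin ?expR_gt0//.
  rewrite le_measure ?inE//; last first.
    by move=> x ex; split => //=; rewrite gee0_abs//; exact: eventG.
  by apply: measurable_lee => //; exact: measurableT_comp.
have := le_trans markov (integral_score_le P n_gt0 eF Fe mF beta0 Phi_measurable
  Phi_invariant Phi_bound s alpha0).
have -> : alpha * ln beta^-1 = kappa alpha * t + - (Num.sqrt t - Num.sqrt (ln beta^-1)) ^+ 2.
  by rewrite -exponent; ring.
rewrite expRD EFinM lee_pmul2l// ?lte_fin ?expR_gt0// => /le_trans; apply.
by rewrite lee_fin ler_expR; lra.
Qed.
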